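(* In the prescreening model with $m\ge2$ potential bidders, $n\in\{2,\dots,m\}$ admitted bidders, predictor $F$ and admitted set $\mathcal I$, the posterior joint density of admitted bidder $i\in\mathcal I$ over the valuations $V_{-i}$ of the other admitted bidders is $$\beta(v_{-i}\mid\mathcal I,v_i;n,F)=\kappa(v_i;n,F)\cdot\psi(v;n,F)\cdot\prod_{j\in\mathcal I\setminus\{i\}}f_1(v_j),\qquad\forall v_{-i}\in[0,1]^{n-1},$$ where $v=(v_i,v_{-i})$, the admission probability is, for all $v\in[0,1]^n$, $$\psi(v;n,F)=\Pr\Big\{\max_{j\in\mathcal I^0\setminus\mathcal I}S_j\le\min_{k\in\mathcal I}S_k\ \Big|\ v\Big\}=\int_0^1\prod_{k\in\mathcal I}[1-F_{2\mid1}(x\mid v_k)]\,d\big(F_2(x)^{m-n}\big)$$ (the integral being read as $1$ when $n=m$), and the normalizing term $\kappa(v_i;n,F)$ is such that $\int_{[0,1]^{n-1}}\beta(v_{-i}\mid\mathcal I,v_i;n,F)\,dv_{-i}=1$.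
   Context: Model. There are $m\ge2$ potential bidders, forming the set $\mathcal I^0$. The valuation–signal pairs $(V_i,S_i)\in[0,1]^2$ are independent across bidders with common joint CDF $F$ (the ''predictor''), whose marginal CDFs $F_1$ (valuations) and $F_2$ (signals) have strictly positive densities $f_1,f_2$ on $[0,1]$; $F_{2\mid1}(s\mid v)=\Pr(S_i\le s\mid V_i=v)$. Standing assumption: $\mathbb E[V_i\mid S_i=s]$ is non-decreasing in $s$. Bidder $i$ observes only $V_i$; only the seller observes the signals. The seller commits before any realization to a number $n$ and, after seeing signals, admits the $n$ bidders with the highest $\mathbb E[V_i\mid S_i=s_i]$; under the standing assumption this is the ranking by signals, so the event that $\mathcal I\subseteq\mathcal I^0$ ($|\mathcal I|=n$) is the admitted set is $\{\max_{j\in\mathcal I^0\setminus\mathcal I}S_j\le\min_{k\in\mathcal I}S_k\}$. Admitted bidders observe the admitted set $\mathcal I$ and their own valuation, and update by Bayes' rule; $\beta(\cdot\mid\mathcal I,v_i;n,F)$ is bidder $i$'s resulting posterior density of $V_{-i}=(V_j)_{j\in\mathcal I\setminus\{i\}}$ given the admitted set $\mathcal I$ and $V_i=v_i$ (for $v_i$ having positive conditional probability of this event). *)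

(* Defs.v *)
From HB Require Import structures.
From mathcomp Require Import all_boot all_order all_algebra.
From mathcomp Require Import all_classical all_reals all_analysis.
From mathcomp Require Import measurable_realfun.

Set Implicit Arguments.
Unset Strict Implicit.
Unset Printing Implicit Defensive.
Import Order.TTheory GRing.Theory Num.Theory.
Import numFieldNormedType.Exports.

Local Open Scope classical_set_scope.
Local Open Scope ring_scope.

Definition unit_itv {R : realType} : set R := `[0, 1].

Section product_probability.
Context {d : measure_display} {T : measurableType d} {R : realType}.

Definition tcons n (p : T * n.-tuple T) : n.+1.-tuple T :=
  [the n.+1.-tuple T of p.1 :: p.2].

Lemma measurable_tcons n : measurable_fun [set: T * n.-tuple T] (@tcons n).
Proof. exact: (measurable_cons measurable_fst measurable_snd). Qed.

HB.instance Definition _ n :=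
  isMeasurableFun.Build _ _ _ _ (@tcons n) (@measurable_tcons n).

Fixpoint product_prob n : ('I_n -> probability T R) ->
    probability (n.-tuple T) R :=
  match n with
  | 0%N => fun=> \d_[tuple]
  | n'.+1 => fun mu =>
      distribution (mu ord0 \x product_prob (fun k => mu (lift ord0 k)))%E
        (@tcons n')
  end.

End product_probability.

(* Lebesgue measure on the cube [0, 1]^k, as a measure on k.-tuple R that
   vanishes outside of the cube. *)
Section lebesgue_cube.
Context (R : realType).

Definition lebesgue01 (A : set R) : \bar R :=
  lebesgue_measure (A `&` unit_itv).

Let mitv01 : measurable (unit_itv : set (measurableTypeR R)).
Proof. exact: measurable_itv. Qed.

Let lebesgue01_0 : lebesgue01 set0 = 0%E.
Proof. exact: (measure0 (mrestr lebesgue_measure mitv01)). Qed.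

Let lebesgue01_ge0 A : (0 <= lebesgue01 A)%E.
Proof. exact: (measure_ge0 (mrestr lebesgue_measure mitv01)). Qed.

Let lebesgue01_sigma_additive : semi_sigma_additive lebesgue01.
Proof.
exact: (@measure_semi_sigma_additive _ _ _
  (mrestr lebesgue_measure mitv01)).
Qed.

HB.instance Definition _ := isMeasure.Build _ _ _ lebesgue01
  lebesgue01_0 lebesgue01_ge0 lebesgue01_sigma_additive.

Lemma lebesgue01_setT : lebesgue01 [set: R] = 1%E.
Proof.
by rewrite /lebesgue01 /unit_itv setTI lebesgue_measure_itv/= lte01 sube0.
Qed.

HB.instance Definition _ :=
  Measure_isProbability.Build _ _ _ lebesgue01 lebesgue01_setT.

Definition lebesgue_cube k : probability (k.-tuple R) R :=
  product_prob (fun _ : 'I_k => lebesgue01 : probability R R).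

Definition cube k : set (k.-tuple R) :=
  [set v | forall j, 0 <= tnth v j <= 1].

End lebesgue_cube.
Arguments lebesgue_cube {R} k.
Arguments cube {R} k.

(* Q is a regular conditional distribution of Z given Y under P. *)
Definition regular_cond_law (R : realType) (d d1 d2 : measure_display)
    (Omega : measurableType d) (T : measurableType d1) (U : measurableType d2)
    (P : probability Omega R) (Z : Omega -> U) (Y : Omega -> T)
    (Q : T -> probability U R) : Prop :=
  (forall E, measurable E -> measurable_fun [set: T] (fun y => Q y E)) /\
  (forall E B, measurable E -> measurable B ->
    P (Z @^-1` E `&` Y @^-1` B) = (\int[P]_(w in Y @^-1` B) Q (Y w) E)%E).

(* A predictor is the joint law F of a valuation-signal pair (V, S), the first
   component being the valuation; it is carried by [0, 1]^2. *)
Section predictor.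
Context {R : realType}.
Implicit Types (F : probability (R * R)%type R) (f : R -> R).

Definition density01 (mu : set R -> \bar R) f : Prop :=
  [/\ measurable_fun unit_itv f,
      (forall x, 0 <= x <= 1 -> 0 < f x) &
      (forall A, measurable A ->
        mu A = \int[lebesgue_measure]_(x in A `&` unit_itv) (f x)%:E)%E].

(* Some version r(s) of E[V | S = s] is non-decreasing on [0, 1]. *)
Definition monotone_regression F : Prop :=
  exists r : R -> R,
    [/\ measurable_fun [set: R] r,
        (forall s t, 0 <= s -> s <= t -> t <= 1 -> r s <= r t) &
        (forall B, measurable B ->
          \int[F]_(p in snd @^-1` B) (p.1)%:E =
          \int[F]_(p in snd @^-1` B) (r p.2)%:E)%E].

Definition predictor F (f1 f2 : R -> R) : Prop :=
  [/\ F (unit_itv `*` unit_itv) = 1%E,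
      density01 (pushforward F fst) f1,
      density01 (pushforward F snd) f2 &
      monotone_regression F].

Definition cdf2 F (x : R) : R := fine (F (snd @^-1` `]-oo, x])).

Definition cdf2X F k (x : R) : R := cdf2 F x ^+ k.

(* K v is the conditional law of S given V = v. *)
Definition cdf2given1 (K : R -> probability R R) (x v : R) : R :=
  fine (K v `]-oo, x]%classic).

End predictor.

Section cdf2X_cumulative.
Context {R : realType} (F : probability (R * R)%type R) (k : nat).

Let snd' : R * R -> R := snd.

#[local] HB.instance Definition _ :=
  isMeasurableFun.Build _ _ _ _ snd' measurable_snd.

Let cdf2E x : cdf2 F x = fine (cdf (snd' : {RV F >-> R}) x).
Proof. by []. Qed.

Let cdf2X_nd : nondecreasing (cdf2X F k).
Proof.
move=> x y xy; rewrite /cdf2X lerXn2r ?nnegrE ?cdf2E ?fine_ge0//.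
by rewrite fine_le ?fin_num_measure// cdf_nondecreasing.
Qed.

Let cdf2X_rc : right_continuous (cdf2X F k).
Proof.
move=> a; have cvgF : cdf2 F x @[x --> a^'+] --> cdf2 F a.
  apply: fine_cvg; rewrite fineK; last first.
    exact: (fin_num_measure (distribution F snd')).
  exact: (cdf_right_continuous (X := (snd' : {RV F >-> R}))).
apply: (@continuous_cvg _ _ _ _ _ (cdf2 F) (fun y : R => y ^+ k)) => //.
exact: exprn_continuous.
Qed.

HB.instance Definition _ :=
  isCumulative.Build R _ R (cdf2X F k) cdf2X_nd cdf2X_rc.

End cdf2X_cumulative.

Section prescreening.
Context {R : realType} {m : nat}.
Implicit Types (F : probability (R * R)%type R) (K : R -> probability R R)
  (I J : {set 'I_m}) (i : 'I_m).

(* Entry j is bidder j's valuation-signal pair. *)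
Definition profile := m.-tuple (R * R)%type.

Definition iid_bidders (d : measure_display) (Omega : measurableType d)
    (P : probability Omega R) F (X : 'I_m -> {mfun Omega >-> (R * R)%type}) :=
  (forall j E, measurable E -> distribution P (X j) E = F E) /\
  (forall J (E : 'I_m -> set (R * R)), (forall j, measurable (E j)) ->
    P (\bigcap_(j in [set` J]) (X j @^-1` E j)) =
    (\prod_(j in J) P (X j @^-1` E j))%E).

Definition profile_of (Omega : Type) (X : 'I_m -> Omega -> R * R) (w : Omega) :
  profile := [tuple X j w | j < m].

Definition valuations_of (Omega : Type) (X : 'I_m -> Omega -> R * R) J
  (w : Omega) : #|J|.-tuple R := [tuple (X (enum_val k) w).1 | k < #|J|].

(* The event that I is the admitted set; the maximum over the empty set is
   -oo, so that the event is certain when everybody is admitted. *)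
Definition admitted I : set profile :=
  [set x | (\big[maxe/-oo]_(j in ~: I) (tnth x j).2%:E <=
            \big[mine/+oo]_(k in I) (tnth x k).2%:E)%E].

(* The valuations of the members of I other than i, in increasing order of
   their labels. *)
Definition rival_valuations k I i (x : profile) : k.-tuple R :=
  [tuple (tnth x (nth i (enum (I :\ i)) l)).1 | l < k].

(* Conditional law of the profile given that the members of J have the
   valuations v, listed in increasing order of the labels. *)
Definition cond_law F K J (v : seq R) : probability profile R :=
  product_prob (fun j => if j \in J
    then let vj := nth 0 v (index j (enum J)) in
         (\d_vj \x K vj)%E : probability (R * R)%type R
    else F).

(* Admission probability of the n = size v admitted bidders. *)
Definition psi F K (v : seq R) : R :=
  if size v == m then 1
  else \int[lebesgue_stieltjes_measure (cdf2X F (m - size v))]_(x in unit_itv)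
         \prod_(u <- v) (1 - cdf2given1 K x u).

(* b is a density on [0, 1]^k of the posterior law of the k rivals' valuations
   given that I is admitted and that i has valuation vi. *)
Definition posterior_density F K I i (vi : R) k (b : k.-tuple R -> R) : Prop :=
  let L := cond_law F K [set i] [:: vi] in
  [/\ measurable_fun (cube k) b,
      (forall w, cube k w -> 0 <= b w) &
      (forall B, measurable B ->
        L (admitted I `&` @rival_valuations k I i @^-1` B) =
        L (admitted I) *
          \int[lebesgue_cube k]_(w in B `&` cube k) (b w)%:E)%E].

End prescreening.
Arguments psi {R} m F K v.

(* Main.v *)
Require Import Defs.
From HB Require Import structures.
From mathcomp Require Import all_boot all_order all_algebra.
From mathcomp Require Import all_classical all_reals all_analysis.
From mathcomp Require Import measurable_realfun giry.

Set Implicit Arguments.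
Unset Strict Implicit.
Unset Printing Implicit Defensive.
Import Order.TTheory GRing.Theory Num.Theory.
Import numFieldNormedType.Exports.

Local Open Scope classical_set_scope.
Local Open Scope ring_scope.

(* Conditionally on the valuations in J, independent pairs stay independent, and
   those in J become (v_j, S_j) with S_j ~ K v_j: on boxes this is Fubini and the
   one-bidder disintegration, and a pi-lambda argument extends it to all events.
   Applied to the i.i.d. law it gives the conditional law of the profile; applied
   to the law given v_i it expresses the joint probability of admission and of
   V_-i in B as the integral over B of the admission probability given (v_i, V_-i)
   against the law of V_-i, whose density is the product of the f1's.
   Given all the admitted valuations, the maximal rejected signal is independent
   of the admitted ones and has the cdf F2^(m-n), whence psi. The total mass, which
   does not depend on the identity of the admitted bidders, determines kappa. *)

(** * Boxes and product measures on tuple spaces *)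

Lemma emeasurable_prod {R : realType} d (T : measurableType d) (J : Type) (r : seq J)
    (P : pred J) (h : J -> T -> \bar R) :
  (forall j, P j -> measurable_fun setT (h j)) ->
  measurable_fun setT (fun x => \prod_(j <- r | P j) h j x)%E.
Proof.
move=> mh; elim: r => [|j r IH].
  by under eq_fun do rewrite big_nil; exact: measurable_cst.
under eq_fun do rewrite big_cons.
by case: (boolP (P j)) => // Pj; apply: emeasurable_funM => //; exact: mh.
Qed.

Section boxes.
Context {d : measure_display} {T : measurableType d}.

Definition box n (E : 'I_n -> set T) : set (n.-tuple T) :=
  [set t | forall j, E j (tnth t j)].

Definition boxes n : set_system (n.-tuple T) :=
  [set box E | E in [set E | forall j, measurable (E j)]].

Lemma measurable_box n (E : 'I_n -> set T) :
  (forall j, measurable (E j)) -> measurable (box E).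
Proof.
move=> mE; rewrite (_ : box E = \bigcap_(j in [set: 'I_n]) (tnth (T := T))^~ j @^-1` E j).
  apply: fin_bigcap_measurable => // j _.
  by rewrite -[X in measurable X]setTI; exact: measurable_tnth.
by apply/seteqP; split => [t h j _|t h j]; exact: h.
Qed.

Lemma boxI n (E E' : 'I_n -> set T) :
  box E `&` box E' = box (fun j => E j `&` E' j).
Proof.
apply/seteqP; split => [t [h h'] j|t h]; first by split; [exact: h|exact: h'].
by split => j; have [] := h j.
Qed.

Lemma boxT n : box (fun _ : 'I_n => [set: T]) = setT.
Proof. by apply/seteqP; split. Qed.

Lemma boxes_setI n : setI_closed (@boxes n).
Proof.
move=> _ _ [E mE <-] [E' mE' <-]; rewrite boxI.
by exists (fun j => E j `&` E' j) => // j; exact: measurableI.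
Qed.

Lemma boxesT n : @boxes n setT.
Proof. by exists (fun=> setT) => //; exact: boxT. Qed.

(** The product sigma-algebra is generated by preimages under single coordinates, and such a
    preimage is a box with all other sides full. *)
Lemma measurable_boxesE n : @measurable _ (n.-tuple T) = <<s @boxes n >>.
Proof.
apply/seteqP; split => [A|]; last first.
  apply: smallest_sub; first exact: sigma_algebra_measurable.
  by move=> _ [E mE <-]; exact: measurable_box.
apply: smallest_sub; first exact: smallest_sigma_algebra.
rewrite -bigcup_seq => B [j _ [C mC <-]]; apply: sub_sigma_algebra.
exists (fun k => if k == j then C else setT) => [k|]; first by case: ifP.
apply/seteqP; split => [t /(_ j)|t [_ Ct] k]; rewrite ?eqxx//.
by case: eqP => [->|].
Qed.

End boxes.

Section box_measures.
Context {d : measure_display} {T : measurableType d} {R : realType}.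

(** Boxes are closed under intersection and generate the sigma-algebra. The whole space is itself a
    box, so for finite measures the constant sequence [setT] serves as the exhausting one. *)
Lemma tuple_measure_unique n (m1 m2 : {finite_measure set (n.-tuple T) -> \bar R}) :
  (forall E : 'I_n -> set T, (forall j, measurable (E j)) -> m1 (box E) = m2 (box E)) ->
  forall A, measurable A -> m1 A = m2 A.
Proof.
move=> m12; apply: (measure_unique (@boxes _ T n) (fun=> setT)).
- exact: measurable_boxesE.
- exact: boxes_setI.
- by move=> _; exact: boxesT.
- by rewrite bigcup_const//; exists 0%N.
- by move=> _ [E mE <-]; exact: m12.
- by move=> _; rewrite -ge0_fin_numE// fin_num_measure.
Qed.

(** Induction on the length: the preimage of a box under [tcons] is a rectangle made of its first
    side and a shorter box. *)
Lemma product_prob_box n (mu : 'I_n -> probability T R) (E : 'I_n -> set T) :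
  (forall j, measurable (E j)) ->
  product_prob mu (box E) = (\prod_j mu j (E j))%E.
Proof.
elim: n mu E => [|n IH] mu E mE /=.
  rewrite big_ord0 diracE mem_set//; by case.
rewrite big_ord_recl -IH; last by move=> j; exact: mE.
rewrite -product_measure1E//; last by apply: measurable_box => j; exact: mE.
rewrite /distribution /pushforward; congr (_ _).
apply/seteqP; split => [[a t] h|[a t] [/= h0 h] j].
  by split => [|j]; [exact: (h ord0)|move: (h (lift ord0 j)); rewrite /= tnthS].
by have [j'|] := unliftP ord0 j; move=> ->; rewrite ?tnthS//; exact: h.
Qed.

Lemma emeasurable_tuple_prod n (g : 'I_n -> T -> \bar R) :
  (forall j, measurable_fun setT (g j)) ->
  measurable_fun [set: n.-tuple T] (fun t => \prod_j g j (tnth t j))%E.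
Proof.
move=> mg; apply: emeasurable_prod => j _.
exact: (measurableT_comp (mg j) (@measurable_tnth _ _ _ j)).
Qed.

(** Induction on the length: Tonelli separates the head coordinate from the others. *)
Lemma ge0_integral_prod_tuple n (mu : 'I_n -> probability T R)
    (h : 'I_n -> T -> \bar R) :
  (forall j, measurable_fun setT (h j)) -> (forall j x, 0 <= h j x)%E ->
  (\int[product_prob mu]_t \prod_j h j (tnth t j) = \prod_j \int[mu j]_x h j x)%E.
Proof.
elim: n mu h => [|n IH] mu h mh h0.
  rewrite big_ord0 /= integral_dirac//; last first.
    by apply: (eq_measurable_fun (cst 1%E)) => // t _; rewrite big_ord0.
  by rewrite diracT big_ord0 mul1e.
rewrite big_ord_recl -IH => [|j|j x]; [|exact: mh|exact: h0].
set q := product_prob _.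
rewrite [LHS]ge0_integral_pushforward//; last 2 first.
- exact: (emeasurable_tuple_prod mh).
- by move=> t _; apply: prode_ge0 => j _; exact: h0.
rewrite (eq_integral (fun p : T * n.-tuple T =>
    h ord0 p.1 * \prod_j h (lift ord0 j) (tnth p.2 j))%E); last first.
  by move=> p _ /=; rewrite big_ord_recl; congr (_ * _)%E;
     apply: eq_bigr => j _; rewrite tnthS.
have mq : measurable_fun [set: n.-tuple T]
    (fun t => \prod_j h (lift ord0 j) (tnth t j))%E.
  exact: (emeasurable_tuple_prod (fun j => mh (lift ord0 j))).
rewrite fubini_tonelli1/=; last 2 first.
- apply: emeasurable_funM; first exact: measurableT_comp.
  exact: (measurableT_comp mq).
- by move=> p; rewrite mule_ge0//; apply: prode_ge0 => j _; exact: h0.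
rewrite /fubini_F/=.
under eq_integral => x _.
  rewrite ge0_integralZl//; last by move=> t _; apply: prode_ge0 => j _; exact: h0.
  over.
rewrite ge0_integralZr//.
by apply: integral_ge0 => t _; apply: prode_ge0 => j _; exact: h0.
Qed.

End box_measures.

(** * Measurability of products of kernels *)

Section measurable_product_kernels.
Context {R : realType} {d d1 : measure_display}.
Context {Y : measurableType d} {T1 : measurableType d1}.

(** A kernel is a measurable map into the Giry space of probabilities, where forming products is
    measurable and so is evaluation at a fixed event. *)
Lemma measurable_product_kernel d2 (T2 : measurableType d2)
    (k1 : Y -> probability T1 R)
    (k2 : Y -> probability T2 R) :
  (forall A, measurable A -> measurable_fun setT (fun y => k1 y A)) ->
  (forall A, measurable A -> measurable_fun setT (fun y => k2 y A)) ->
  forall E, measurable E -> measurable_fun setT (fun y => (k1 y \x k2 y)%E E).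
Proof.
move=> mk1 mk2 E mE.
pose g1 y : giry T1 R := k1 y; pose g2 y : giry T2 R := k2 y.
have mg1 : measurable_fun setT g1 by exact: measurable_giry_codensity.
have mg2 : measurable_fun setT g2 by exact: measurable_giry_codensity.
have := measurableT_comp (measurable_giry_ev mE)
  (measurableT_comp measurable_giry_prod (measurable_fun_pair mg1 mg2)).
exact.
Qed.

Lemma measurable_product_prob n (k : 'I_n -> Y -> probability T1 R) :
  (forall j A, measurable A -> measurable_fun setT (fun y => k j y A)) ->
  forall E, measurable E ->
    measurable_fun setT (fun y => product_prob (fun j => k j y) E).
Proof.
elim: n k => [|n IH] k mk E mE /=; first exact: measurable_cst.
apply: (measurable_product_kernel (mk ord0)
  (IH (fun j => k (lift ord0 j)) (fun j => mk (lift ord0 j)))).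
by rewrite -[X in measurable X]setTI; exact: measurable_tcons.
Qed.

End measurable_product_kernels.

(** * Identification of mixtures of measures *)

Section mixtures.
Context {R : realType} {d d' : measure_display}.
Context {Omega : measurableType d} {U : measurableType d'}.

(** The events satisfying the identity form a Dynkin system, so a generating pi-system suffices.
    Finiteness of [nu] allows the cancellation in the complement step. *)
Lemma kernel_mixture_unique (m : {measure set Omega -> \bar R})
    (nu : {measure set U -> \bar R}) (C : set Omega)
    (Q : Omega -> {measure set U -> \bar R}) (G : set_system U) :
  fin_num_fun nu -> measurable C ->
  (forall E, measurable E -> measurable_fun C (fun w => Q w E)) ->
  measurable = <<s G >> -> setI_closed G -> G setT ->
  (forall E, G E -> nu E = \int[m]_(w in C) Q w E)%E ->
  forall E, measurable E -> (nu E = \int[m]_(w in C) Q w E)%E.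
Proof.
move=> nufin mC mQ GE GI GT GnuE E; rewrite GE; move: E.
apply: dynkin_induction => //; first exact: GnuE.
- move=> S mS SE.
  have QT : (nu setT = \int[m]_(w in C) Q w S + \int[m]_(w in C) Q w (~` S))%E.
    rewrite GnuE// -ge0_integralD//; last 2 first.
      exact: mQ.
      by apply: mQ; exact: measurableC.
    apply: eq_integral => w _; rewrite -measureU//.
    - by rewrite setUv.
    - exact: measurableC.
    - by rewrite setICr.
  have nuS : nu S \is a fin_num by exact: nufin.
  rewrite -[LHS](addeK _ nuS) -[RHS](addeK _ nuS); congr (_ - _)%E.
  rewrite [in RHS]SE [RHS]addeC -QT -measureU ?setvU ?setICl//.
  exact: measurableC.
- move=> S mS tS SE; rewrite measure_semi_bigcup//; last exact: bigcup_measurable.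
  under eq_integral => w _.
    rewrite measure_semi_bigcup//; last exact: bigcup_measurable.
    over.
  rewrite integral_nneseries//; last by move=> k; exact: mQ.
  by apply: eq_eseriesr => k _; exact: SE.
Qed.

End mixtures.

(** * Disintegration of one bidder's pair along the valuation *)

Section known_valuation.
Context {R : realType}.

Definition known_valuation (K : R -> probability R R) (v : R) :
  probability (R * R)%type R := (\d_v \x K v)%E.

Lemma known_valuation_rect (K : R -> probability R R) v (A S : set R) :
  measurable A -> measurable S ->
  known_valuation K v (A `*` S) = (\d_v A * K v S)%E.
Proof. by move=> mA mS; rewrite /known_valuation /= product_measure1E. Qed.

Lemma measurable_known_valuation (K : R -> probability R R) :
  (forall S, measurable S -> measurable_fun setT (fun v => K v S)) ->
  forall E, measurable E -> measurable_fun setT (fun v => known_valuation K v E).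
Proof.
move=> mK E mE; apply: (measurable_product_kernel _ mK mE) => A mA.
exact: measurable_fun_dirac.
Qed.

(** [K] describes the signal only. For a rectangle, the constraint on the valuation joins the
    conditioning set, and what remains is an event about the signal, to which the hypothesis on [K]
    applies; rectangles then determine the mixture. *)
Lemma known_valuation_cond (F : probability (R * R)%type R)
    (K : R -> probability R R) :
  regular_cond_law F snd fst K ->
  forall E B, measurable E -> measurable B ->
  (F (E `&` fst @^-1` B) =
    \int[F]_(p in fst @^-1` B) known_valuation K p.1 E)%E.
Proof.
move=> [mK KF] E B mE mB.
have mfB (A : set R) : measurable A -> measurable (fst @^-1` A : set (R * R)).
  by move=> mA; rewrite -[X in measurable X]setTI; exact: measurable_fst.
apply: (@kernel_mixture_unique _ _ _ _ _ F (mrestr F (mfB _ mB)) _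
  (fun p => known_valuation K p.1)
  [set A `*` S | A in measurable & S in measurable]) => //.
- exact: mfB.
- move=> S mS; apply: (measurable_funS measurableT) => //.
  exact: (measurableT_comp (measurable_known_valuation mK mS)).
- exact: measurable_prod_measurableType.
- move=> _ _ [A1 mA1 [A2 mA2 <-]] [B1 mB1 [B2 mB2 <-]].
  rewrite -setXI; exists (A1 `&` B1); first exact: measurableI.
  by exists (A2 `&` B2) => //; exact: measurableI.
- by exists setT => //; exists setT => //; rewrite setXTT.
- move=> _ [A mA [S mS <-]].
  transitivity (F (snd @^-1` S `&` fst @^-1` (B `&` A))).
    congr (F _); apply/seteqP; split => [[x y] /= [[? ?] ?]|[x y] /= [? [? ?]]].
      by split.
    by split.
  rewrite KF//; last exact: measurableI.
  rewrite preimage_setI integral_mkcondr; apply: eq_integral => p _.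
  rewrite [RHS]known_valuation_rect// patchE diracE.
  rewrite (_ : (p \in fst @^-1` A) = (p.1 \in A)); last first.
    by apply/idP/idP => /set_mem/= h; exact: mem_set.
  by case: ifP => _; rewrite ?mul1e ?mul0e.
Qed.

End known_valuation.

(** * Disintegration of a product law along some bidders' valuations *)

Section disintegration.
Context {R : realType} {n k : nat}.
Variables (F : probability (R * R)%type R) (K : R -> probability R R).
Hypothesis hK : regular_cond_law F snd fst K.
Variables (J : {set 'I_n}) (mu : 'I_n -> probability (R * R)%type R).
Hypothesis muJ : forall j, j \in J -> mu j = F.
Variable g : 'I_k -> 'I_n.
Hypothesis gJ : forall l, g l \in J.

(** The abstract index map [g] serves both the listing of all members of a conditioning set and the
    listing of the rivals of a given bidder. *)
Definition valuations_at (x : n.-tuple (R * R)) : k.-tuple R :=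
  [tuple (tnth x (g l)).1 | l < k].

Lemma measurable_valuations_at : measurable_fun setT valuations_at.
Proof.
apply/measurable_fun_tnthP => l.
apply: (eq_measurable_fun (fun x : n.-tuple (R * R) => (tnth x (g l)).1)).
  by move=> x _ /=; rewrite tnth_mktuple.
exact: (measurableT_comp measurable_fst (@measurable_tnth _ _ _ _)).
Qed.

Lemma measurable_preimage_valuations_at B : measurable B ->
  measurable (valuations_at @^-1` B).
Proof.
by move=> mB; rewrite -[X in measurable X]setTI; exact: measurable_valuations_at.
Qed.

(** The law of a fresh profile sharing with [x] only the valuations in [J]: the candidate for the
    conditional law given those valuations. *)
Definition revealed (x : n.-tuple (R * R)) (j : 'I_n) :=
  if j \in J then known_valuation K (tnth x j).1 else mu j.

Lemma measurable_revealed_coord j E : measurable E ->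
  measurable_fun setT (fun p : R * R =>
    (if j \in J then known_valuation K p.1 else mu j) E).
Proof.
move=> mE; case: (j \in J); last exact: measurable_cst.
exact: (measurableT_comp (measurable_known_valuation hK.1 mE)).
Qed.

Lemma measurable_revealed E : measurable E ->
  measurable_fun setT (fun x => product_prob (revealed x) E).
Proof.
apply: (measurable_product_prob (k := fun j x => revealed x j)) => j A mA.
exact: (measurableT_comp (measurable_revealed_coord j mA) (@measurable_tnth _ _ _ _)).
Qed.

Lemma revealed_cond_coord j E B : measurable E -> measurable B ->
  (j \notin J -> B = setT) ->
  (mu j (E `&` fst @^-1` B) = \int[mu j]_(p in fst @^-1` B)
     (if j \in J then known_valuation K p.1 else mu j) E)%E.
Proof.
move=> mE mB; case: (boolP (j \in J)) => [jJ _|jJ /(_ isT) ->].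
  by rewrite muJ//; exact: known_valuation_cond.
by rewrite preimage_setT setIT integral_cst// [X in (_ * X)%E]probability_setT mule1.
Qed.

(** On boxes both sides factor over the bidders, which reduces the identity to the disintegration of
    a single pair. *)
Lemma revealed_cond_box (E : 'I_n -> set (R * R)) (B : 'I_k -> set R) :
  (forall j, measurable (E j)) -> (forall l, measurable (B l)) ->
  (product_prob mu (box E `&` valuations_at @^-1` box B) =
   \int[product_prob mu]_(x in valuations_at @^-1` box B)
     product_prob (revealed x) (box E))%E.
Proof.
move=> mE mB.
(* Several positions [l] may point to the same bidder, so [D j] gathers all the constraints on the
   valuation of [j]. Outside [J] the intersection is empty-indexed, hence the whole line. *)
pose D j := \bigcap_(l in [set l | g l = j]) B l.
have mD j : measurable (D j) by exact: fin_bigcap_measurable.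
have mfD j : measurable (fst @^-1` D j : set (R * R)).
  by rewrite -[X in measurable X]setTI; exact: measurable_fst.
have DT j : j \notin J -> D j = setT.
  move=> jJ; rewrite -subTset => x _ l /= gl.
  by move: (gJ l); rewrite gl (negbTE jJ).
have -> : valuations_at @^-1` box B = box (fun j => fst @^-1` D j).
  apply/seteqP; split => [x h j l /= <-|x h l /=].
    by move: (h l); rewrite tnth_mktuple.
  by rewrite tnth_mktuple; exact: (h (g l)).
rewrite boxI product_prob_box => [|j]; last exact: measurableI.
pose h j (p : R * R) : \bar R :=
  (((fun p => (if j \in J then known_valuation K p.1 else mu j) (E j)) \_
    (fst @^-1` D j)) p)%E.
transitivity (\prod_j \int[mu j]_p h j p)%E.
  apply: eq_bigr => j _; rewrite revealed_cond_coord//; last exact: DT.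
  by rewrite integral_mkcond.
rewrite -ge0_integral_prod_tuple; last 2 first.
- move=> j; apply/(measurable_restrictT _ (mfD j)).
  by apply: (measurable_funS measurableT) => //; exact: measurable_revealed_coord.
- by move=> j p; rewrite /h patchE; case: ifP.
rewrite [RHS]integral_mkcond; apply: eq_integral => x _.
rewrite patchE product_prob_box//; case: ifPn => [/set_mem xD|xD].
  apply: eq_bigr => j _; rewrite /h patchE mem_set; last exact: (xD j).
  by rewrite /revealed; case: ifP.
have [j xj] : exists j, ~ D j (tnth x j).1.
  by apply/existsNP => h0; move/negP: xD; apply; exact: mem_set.
by rewrite (bigD1 j)//= {1}/h patchE memNset// mul0e.
Qed.

(** Two successive extensions from boxes: first in [E] with [B] still a box, then in [B] with [E]
    arbitrary. *)
Lemma revealed_cond (E : set (n.-tuple (R * R))) (B : set (k.-tuple R)) :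
  measurable E -> measurable B ->
  (product_prob mu (E `&` valuations_at @^-1` B) =
   \int[product_prob mu]_(x in valuations_at @^-1` B)
     product_prob (revealed x) E)%E.
Proof.
have step1 (B' : 'I_k -> set R) E' : (forall l, measurable (B' l)) ->
    measurable E' ->
    (product_prob mu (E' `&` valuations_at @^-1` box B') =
     \int[product_prob mu]_(x in valuations_at @^-1` box B')
       product_prob (revealed x) E')%E.
  move=> mB' mE'.
  have mC := measurable_preimage_valuations_at (measurable_box mB').
  apply: (@kernel_mixture_unique _ _ _ _ _ (product_prob mu)
    (mrestr (product_prob mu) mC) _
    (fun x => product_prob (revealed x)) (@boxes _ _ n)) => //.
  - by move=> A mA; apply: (measurable_funS measurableT) => //;
      exact: measurable_revealed.
  - exact: measurable_boxesE.
  - exact: boxes_setI.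
  - exact: boxesT.
  - by move=> _ [A mA <-]; exact: revealed_cond_box.
move=> mE mB.
(* For fixed E, the right-hand side is a mixture over x of multiples of Dirac
   masses at [valuations_at x], hence is determined by its values on boxes. *)
pose q x : {nonneg R} :=
  NngNum (fine_ge0 (measure_ge0 (product_prob (revealed x)) E)).
have qE x : (q x)%:num%:E = product_prob (revealed x) E.
  by rewrite /= fineK// fin_num_measure.
pose Q x : {measure set (k.-tuple R) -> \bar R} :=
  mscale (q x) (\d_(valuations_at x)).
have QE x A : Q x A = ((fun x => product_prob (revealed x) E) \_
    (valuations_at @^-1` A)) x.
  rewrite -[LHS]/((q x)%:num%:E * \d_(valuations_at x) A)%E qE diracE patchE.
  rewrite (_ : (x \in valuations_at @^-1` A) = (valuations_at x \in A)); last first.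
    by apply/idP/idP => /set_mem/= h; exact: mem_set.
  by case: ifP => _; rewrite ?mule1 ?mule0.
transitivity (\int[product_prob mu]_(x in setT) Q x B)%E; last first.
  by rewrite [RHS]integral_mkcond; apply: eq_integral => x _; exact: QE.
pose Y : {mfun _ >-> _} := HB.pack valuations_at
  (isMeasurableFun.Build _ _ _ _ _ measurable_valuations_at).
(* The roles are exchanged: [E] becomes the set to which the measure is restricted, and [B] the
   event that varies. *)
rewrite setIC.
apply: (@kernel_mixture_unique _ _ _ _ _ (product_prob mu)
    (pushforward (mrestr (product_prob mu) mE) Y) _ Q (@boxes _ _ k)) => //.
- by move=> A mA; rewrite /= /pushforward fin_num_measure//;
    exact: measurable_preimage_valuations_at.
- move=> A mA; apply: (eq_measurable_fun
    ((fun x => product_prob (revealed x) E) \_ (valuations_at @^-1` A))).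
    by move=> x _; rewrite QE.
  apply/(measurable_restrictT _ (measurable_preimage_valuations_at mA)).
  by apply: (measurable_funS measurableT) => //; exact: measurable_revealed.
- exact: measurable_boxesE.
- exact: boxes_setI.
- exact: boxesT.
- move=> _ [A mA <-]; rewrite [LHS]/= /pushforward /mrestr setIC step1//.
  by rewrite [LHS]integral_mkcond; apply: eq_integral => x _; rewrite QE.
Qed.

End disintegration.

(** * Conditional law of the profile of independent bidders *)

Lemma measurable_nth_tuple {R : realType} n i :
  measurable_fun setT (fun v : n.-tuple R => nth 0 v i).
Proof.
have [ni|iltn] := leqP n i.
  rewrite (_ : (fun v => _) = cst 0); first exact: measurable_cst.
  by apply/funext => v; rewrite nth_default// size_tuple.
rewrite (_ : (fun v => _) = fun v : n.-tuple R => tnth v (Ordinal iltn)).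
  exact: measurable_tnth.
by apply/funext => v; rewrite (tnth_nth 0).
Qed.

Section independent_bidders.
Context {R : realType} {m : nat} {d : measure_display} {Omega : measurableType d}.
Variables (P : probability Omega R) (F : probability (R * R)%type R).
Variable X : 'I_m -> {mfun Omega >-> (R * R)%type}.
Hypothesis hX : iid_bidders P F X.

Lemma measurable_profile_of : measurable_fun setT (profile_of X).
Proof.
apply/measurable_fun_tnthP => j.
apply: (eq_measurable_fun (X j)) => // w _.
by rewrite /= tnth_mktuple.
Qed.

HB.instance Definition _ :=
  isMeasurableFun.Build _ _ _ _ (profile_of X) measurable_profile_of.

(** Independence over the full index set gives the product formula on boxes, and boxes determine a
    finite measure. *)
Lemma profile_law E : measurable E ->
  distribution P (profile_of X) E = product_prob (fun _ : 'I_m => F) E.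
Proof.
move: E; apply: tuple_measure_unique => E mE.
rewrite [RHS]product_prob_box//.
transitivity (P (\bigcap_(j in [set` [set: 'I_m]%SET]) (X j @^-1` E j))).
  rewrite /distribution /pushforward; congr (P _).
  apply/seteqP; split => [w h j _|w h j]; first by move: (h j); rewrite tnth_mktuple.
  by rewrite tnth_mktuple; apply: h; rewrite /= inE.
rewrite hX.2//; apply: eq_big => [j|j _]; first by rewrite inE.
by rewrite -(hX.1 j).
Qed.

(** [cond_law] looks up a valuation by its position in [enum J]; this position leads back to the
    bidder's own valuation in [x]. *)
Lemma cond_law_revealed K (J : {set 'I_m}) (x : profile) :
  cond_law F K J (valuations_at (@enum_val _ (mem J)) x) =
  product_prob (revealed K J (fun=> F) x).
Proof.
rewrite /cond_law; congr product_prob; apply/funext => j; rewrite /revealed.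
case: ifP => // jJ; rewrite /known_valuation.
suff -> : nth 0 (valuations_at (@enum_val _ (mem J)) x) (index j (enum J)) =
  (tnth x j).1 by [].
have iJ : (index j (enum J) < #|J|)%N by rewrite cardE index_mem mem_enum.
rewrite -[index _ _]/(nat_of_ord (Ordinal iJ)) -tnth_nth tnth_mktuple.
by rewrite (enum_val_nth j) /= nth_index// mem_enum.
Qed.

Lemma cond_law_regular K (J : {set 'I_m}) : regular_cond_law F snd fst K ->
  regular_cond_law P (profile_of X) (valuations_of X J)
    (fun v : #|J|.-tuple R => cond_law F K J v).
Proof.
move=> hK; split => [E mE|E B mE mB].
  apply: (measurable_product_prob (k := fun j (v : #|J|.-tuple R) =>
    if j \in J then known_valuation K (nth 0 v (index j (enum J))) else F)) => //.
  move=> j A mA; case: (j \in J); last exact: measurable_cst.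
  exact: (measurableT_comp (measurable_known_valuation hK.1 mA)
    (@measurable_nth_tuple _ _ _)).
pose g := @enum_val _ (mem J).
have gJ l : g l \in J by exact: enum_valP.
have Vg w : valuations_of X J w = valuations_at g (profile_of X w).
  by apply: eq_from_tnth => l; rewrite !tnth_mktuple.
transitivity (product_prob (fun _ : 'I_m => F) (E `&` valuations_at g @^-1` B)).
  rewrite -profile_law; last first.
    by apply: measurableI => //; exact: measurable_preimage_valuations_at.
  rewrite /distribution /pushforward; congr (P _).
  by apply/seteqP; split => w /=; rewrite Vg.
rewrite (revealed_cond hK _ gJ)//.
transitivity (\int[distribution P (profile_of X)]_(x in valuations_at g @^-1` B)
    product_prob (revealed K J (fun=> F) x) E)%E.
  by apply: eq_measure_integral => A mA _; symmetry; exact: profile_law.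
rewrite ge0_integral_pushforward//; last 2 first.
- exact: measurable_preimage_valuations_at.
- apply: (measurable_funS measurableT) => //.
  by apply: (measurable_revealed hK).
rewrite (_ : _ @^-1` _ = valuations_of X J @^-1` B); last first.
  by apply/seteqP; split => w /=; rewrite Vg.
by apply: eq_integral => w _; rewrite Vg cond_law_revealed.
Qed.

End independent_bidders.

(** * The admission event and the largest rejected signal *)

Section admission_event.
Context {R : realType} {m : nat} (I : {set 'I_m}).
Implicit Types x : @profile R m.

(** The infinite defaults of the extended maximum and minimum never bind, so only pairwise
    comparisons remain; they are vacuous when nobody is rejected. *)
Lemma admittedP x : admitted I x <->
  forall j k, j \notin I -> k \in I -> (tnth x j).2 <= (tnth x k).2.
Proof.
rewrite /admitted /=; split => [/bigmax_leP[_ h] j k jI kI|h].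
  have /h/bigmin_geP[_ /(_ _ kI)] : j \in ~: I by rewrite inE.
  by rewrite lee_fin.
apply/bigmax_leP; split => [|j]; first exact: leNye.
rewrite inE => jI; apply/bigmin_geP; split => [|k kI]; first exact: leey.
by rewrite lee_fin h.
Qed.

Lemma measurable_signal j : measurable_fun setT (fun x => (tnth x j).2).
Proof. exact: (measurableT_comp measurable_snd (@measurable_tnth _ _ _ _)). Qed.

Lemma measurable_admitted : measurable (admitted I : set (@profile R m)).
Proof.
rewrite (_ : admitted I = \bigcap_(j in [set j | j \notin I])
    \bigcap_(k in [set k | k \in I])
      [set x : @profile R m | (tnth x j).2 <= (tnth x k).2]).
  apply: fin_bigcap_measurable => // j _; apply: fin_bigcap_measurable => // k _.
  rewrite -[X in measurable X]setTI; apply: measurable_fun_le => //;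
    exact: measurable_signal.
apply/seteqP; split => [x /admittedP h j /= jI k /= kI|x h]; first exact: h.
by apply/admittedP => j k jI kI; exact: h.
Qed.

Section max_signal.
Variables (j0 : 'I_m) (j0I : j0 \notin I).

(** Starting the maximum at the signal of a rejected bidder [j0] keeps it real-valued; as [j0] takes
    part in the maximum anyway, its value is not altered. *)
Definition max_signal x : R :=
  \big[Num.max/(tnth x j0).2]_(j in ~: I) (tnth x j).2.

Lemma max_signal_le x t :
  max_signal x <= t <-> forall j, j \notin I -> (tnth x j).2 <= t.
Proof.
split => [/bigmax_leP[_ h] j jI|h]; first by apply: h; rewrite inE.
by apply/bigmax_leP; split => [|j]; rewrite ?inE; exact: h.
Qed.

Lemma max_signal_lt x t :
  max_signal x < t <-> forall j, j \notin I -> (tnth x j).2 < t.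
Proof.
split => [/bigmax_ltP[_ h] j jI|h]; first by apply: h; rewrite inE.
by apply/bigmax_ltP; split => [|j]; rewrite ?inE; exact: h.
Qed.

Lemma measurable_max_signal : measurable_fun setT max_signal.
Proof.
rewrite /max_signal unlock; elim: (index_enum _) => [|j s IH] /=.
  exact: measurable_signal.
case: (j \in ~: I) => //.
exact: (measurable_maxr (measurable_signal j) IH).
Qed.

HB.instance Definition _ :=
  isMeasurableFun.Build _ _ _ _ max_signal measurable_max_signal.

End max_signal.
End admission_event.

(** * Null sets of the signal marginal *)

Section marginal_signal.
Context {R : realType} (F : probability (R * R)%type R) (f1 f2 : R -> R).
Hypothesis hF : predictor F f1 f2.

Lemma measurable_snd_preimage (A : set R) : measurable A ->
  measurable (snd @^-1` A : set (R * R)).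
Proof. by move=> mA; rewrite -[X in measurable X]setTI; exact: measurable_snd. Qed.

(** The signal has a density on the unit interval. Both the absence of atoms and the support in
    [unit_itv] follow from this. *)
Lemma signal_null (N : set R) : measurable N ->
  lebesgue_measure (N `&` unit_itv) = 0%E -> F (snd @^-1` N) = 0%E.
Proof.
case: hF => _ _ [mf2 _ f2E] _ mN N0.
have mU : measurable (unit_itv : set R) by exact: measurable_itv.
have := f2E _ mN; rewrite /pushforward => ->.
apply: null_set_integral => //; first exact: measurableI.
by apply/measurable_EFinP; apply: measurable_funS mf2.
Qed.

Lemma signal_atomless y : F (snd @^-1` [set y]) = 0%E.
Proof.
apply: signal_null => //; have [yU|yU] := pselect (unit_itv y).
  by rewrite setIidl ?lebesgue_measure_set1// => _ ->.
by rewrite (_ : _ `&` _ = set0) ?measure0// -subset0 => _ [-> /yU].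
Qed.

Lemma signal_unit_itv : F (snd @^-1` (~` unit_itv)) = 0%E.
Proof.
apply: signal_null; first by apply: measurableC; exact: measurable_itv.
by rewrite setICl measure0.
Qed.

End marginal_signal.

Section resampling.
Context {d : measure_display} {T : measurableType d} {R : realType} {n : nat}.
Variables (mu : 'I_n -> probability T R) (I : {set 'I_n}).

Definition splice (p : n.-tuple T * n.-tuple T) : n.-tuple T :=
  [tuple if j \in I then tnth p.2 j else tnth p.1 j | j < n].

Lemma measurable_splice : measurable_fun setT splice.
Proof.
apply/measurable_fun_tnthP => j.
apply: (eq_measurable_fun (fun p : n.-tuple T * n.-tuple T =>
    if j \in I then tnth p.2 j else tnth p.1 j)).
  by move=> p _; rewrite /= tnth_mktuple.
case: (j \in I).
  exact: (measurableT_comp (@measurable_tnth _ _ _ j) measurable_snd).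
exact: (measurableT_comp (@measurable_tnth _ _ _ j) measurable_fst).
Qed.

HB.instance Definition _ :=
  isMeasurableFun.Build _ _ _ _ splice measurable_splice.

(* Splicing two independent copies makes the coordinates outside of I
   independent of those in I without reordering the bidders. *)
Lemma product_prob_splice A : measurable A ->
  (product_prob mu A = \int[product_prob mu]_x
     product_prob mu [set y | A (splice (x, y))])%E.
Proof.
move=> mA; pose L2 := (product_prob mu \x product_prob mu)%E.
have -> : product_prob mu A = distribution L2 splice A.
  move: A mA; apply: tuple_measure_unique => E mE.
  pose E1 j := if j \in I then setT else E j.
  pose E2 j := if j \in I then E j else setT.
  have mE1 j : measurable (E1 j) by rewrite /E1; case: ifP.
  have mE2 j : measurable (E2 j) by rewrite /E2; case: ifP.
  transitivity (L2 (box E1 `*` box E2)).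
    rewrite /L2 product_measure1E; [|exact: measurable_box|exact: measurable_box].
    rewrite [LHS]product_prob_box// [X in (X * _)%E]product_prob_box//.
    rewrite [X in (_ * X)%E]product_prob_box// -big_split/=.
    apply: eq_bigr => j _; rewrite /E1 /E2.
    by case: ifP => _; rewrite probability_setT ?mul1e ?mule1.
  rewrite /distribution /pushforward; congr (L2 _).
  apply/seteqP; split => [[x y] [/= h1 h2] j|[x y] h].
    rewrite tnth_mktuple /=; move: (h1 j) (h2 j); rewrite /E1 /E2.
    by case: ifP.
  by split => j; move: (h j); rewrite tnth_mktuple /E1 /E2 /=; case: ifP.
rewrite /distribution /pushforward; apply: eq_integral => x _ /=.
by congr (product_prob mu _); apply/seteqP; split => y /=; rewrite /xsection/= inE.
Qed.

End resampling.

(** * Upper tails, and the law of the largest rejected signal *)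

Lemma probability_itvcy_atomless {R : realType} (k : probability R R) (t : R) :
  k [set t] = 0%E -> k `[t, +oo[%classic = (1 - fine (k `]-oo, t]%classic))%:E.
Proof.
move=> kt; have mI : measurable (`]-oo, t[%classic : set R) by exact: measurable_itv.
have mI' : measurable (`]-oo, t]%classic : set R) by exact: measurable_itv.
rewrite -setCitvl probability_setC// EFinB fineK ?fin_num_measure//.
rewrite (_ : `]-oo, t]%classic = `]-oo, t[ `|` [set t]); last first.
  by apply/seteqP; split => x /=; rewrite !in_itv/= le_eqVlt;
    [move=> /orP[/eqP|]; [right|left]|move=> [->|->]; rewrite ?orbT ?eqxx].
rewrite measureU//.
  by congr (_ - _)%E; rewrite -[LHS]adde0; congr (_ + _)%E; exact/esym/kt.
by rewrite -subset0 => x [/=]; rewrite in_itv/= => /[swap] ->; rewrite ltxx.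
Qed.

Section max_signal_law.
Context {R : realType} {m : nat} (I : {set 'I_m}).
Variables (F : probability (R * R)%type R) (f1 f2 : R -> R).
Hypothesis hF : predictor F f1 f2.
Variable mu : 'I_m -> probability (R * R)%type R.
Hypothesis muC : forall j, j \notin I -> mu j = F.

Let L := product_prob mu.

Lemma others_box (N : set R) : measurable N -> F (snd @^-1` N) = 0%E ->
  L (box (fun j => if j \in I then setT else snd @^-1` (~` N))) = 1%E.
Proof.
move=> mN FN; rewrite /L product_prob_box => [|j]; last first.
  by case: ifP => // _; apply: measurable_snd_preimage; exact: measurableC.
rewrite big1// => j _; case: ifPn => [_|jI]; first exact: probability_setT.
rewrite muC// preimage_setC probability_setC ?FN ?sube0//.
exact: measurable_snd_preimage.
Qed.

Section some_rejected.
Variables (j0 : 'I_m) (j0I : j0 \notin I).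

Let G : probability R R := distribution L (max_signal I j0).

(** Almost surely every rejected signal avoids the null set [N], and by the second hypothesis the
    maximum then avoids it too. *)
Lemma max_signal_null N : measurable N ->
  (forall x : profile, (forall j, j \notin I -> ~ N (tnth x j).2) ->
    ~ N (max_signal I j0 x)) ->
  F (snd @^-1` N) = 0%E -> G N = 0%E.
Proof.
move=> mN hN FN.
set B := box (fun j => if j \in I then setT else snd @^-1` (~` N)) : set (profile).
have mB : measurable B.
  by apply: measurable_box => j; case: ifP => // _;
    apply: measurable_snd_preimage; exact: measurableC.
apply: (subset_measure0 (B := ~` B)) => //.
- by rewrite -[X in measurable X]setTI; exact: measurable_max_signal.
- exact: measurableC.
- move=> x /= Nx Bx; apply: (hN x) => // j jI.
  by move: (Bx j); rewrite (negbTE jI).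
- transitivity (1 - L B)%E; first exact: probability_setC.
  by rewrite /B others_box// subee.
Qed.

Lemma max_signal_atomless y : G [set y] = 0%E.
Proof.
apply: max_signal_null => //; last exact: (signal_atomless hF).
(* If the maximum were [y] while no rejected signal equals [y], all rejected signals would lie
   strictly below [y], and so would their maximum. *)
move=> x h /= My; have : max_signal I j0 x <= y by rewrite My.
move=> /max_signal_le hle; suff : max_signal I j0 x < y by rewrite My ltxx.
by apply/max_signal_lt => // j jI; rewrite lt_neqAle hle// andbT; apply/eqP/h.
Qed.

Lemma max_signal_unit_itv : G (~` unit_itv) = 0%E.
Proof.
apply: max_signal_null; last exact: (signal_unit_itv hF).
  by apply: measurableC; exact: measurable_itv.
move=> x h; apply; have h' j : j \notin I -> 0 <= (tnth x j).2 <= 1.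
  by move=> /h /contrapT; rewrite /unit_itv /= in_itv.
rewrite /unit_itv /= in_itv /=; apply/andP; split.
  have [+ _] := andP (h' _ j0I); move=> /le_trans; apply.
  by have /max_signal_le := lexx (max_signal I j0 x); apply.
by apply/max_signal_le => // j /h' /andP[].
Qed.

(** The maximum is at most [t] exactly on a box whose sides are constrained for rejected bidders
    only; these are independent with law [F], and there are [m - #|I|] of them. *)
Lemma max_signal_cdf t : G `]-oo, t]%classic = (cdf2X F (m - #|I|) t)%:E.
Proof.
rewrite -[LHS]/(L (max_signal I j0 @^-1` `]-oo, t]%classic)).
rewrite (_ : _ @^-1` _ =
    box (fun j => if j \in I then setT else snd @^-1` `]-oo, t]%classic)); last first.
  apply/seteqP; split => [x /=|x h /=]; rewrite in_itv/=.
    move=> /(max_signal_le j0I) h j; case: ifPn => //= jI.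
    by rewrite in_itv/= h.
  apply/(max_signal_le j0I) => j jI; move: (h j); rewrite (negbTE jI) /=.
  by rewrite in_itv.
rewrite /L product_prob_box => [|j]; last first.
  by case: ifP => // _; apply: measurable_snd_preimage; exact: measurable_itv.
rewrite (bigID (mem I))/= big1 ?mul1e; last first.
  by move=> j ->; exact: probability_setT.
rewrite (eq_bigr (fun=> (cdf2 F t)%:E)); last first.
  move=> j jI; rewrite (negbTE jI) muC// /cdf2 fineK// fin_num_measure//.
  by apply: measurable_snd_preimage; exact: measurable_itv.
rewrite prodEFin prodr_const /cdf2X; congr (_ ^+ _)%:E.
by rewrite -[X in (X - _)%N]card_ord -(cardsC I) addKn; apply: eq_card => j; rewrite !inE.
Qed.

(** The same map with codomain [measurableTypeR R], the type that carries the Lebesgue-Stieltjes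
    measure. *)
Let max_signalTR : profile -> measurableTypeR R := max_signal I j0.

#[local] HB.instance Definition _ := isMeasurableFun.Build _ _ _ _
  max_signalTR (measurable_max_signal I j0 : measurable_fun setT max_signalTR).

(** A Stieltjes measure is determined by its values on the intervals []a, b]], which are increments
    of the cdf computed in [max_signal_cdf]. *)
Lemma lebesgue_stieltjes_max_signal (A : set (measurableTypeR R)) : measurable A ->
  lebesgue_stieltjes_measure (cdf2X F (m - #|I|)) A = distribution L max_signalTR A.
Proof.
move: A; apply: lebesgue_stieltjes_measure_unique => _ [[a b]]/= _ <-.
rewrite /lebesgue_stieltjes_measure /measure_extension/=.
rewrite measurable_mu_extE/=; last exact: is_ocitv.
have [ab | ba] := leP a b; last first.
  by rewrite set_itv_ge ?wlength0 ?measure0// bnd_simp -leNgt ltW.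
rewrite wlength_itv_bnd// EFinB -!max_signal_cdf.
have : `]a, b]%classic = `]-oo, b] `\` `]-oo, a] => [|->].
  by rewrite -[RHS]setCK setCD setCitvl setUC -[LHS]setCK setCitv.
transitivity (G (`]-oo, b] `\` `]-oo, a])) => //.
rewrite measureD ?setIidr//; first exact: subset_itvl.
by rewrite -ge0_fin_numE// fin_num_measure.
Qed.

End some_rejected.
End max_signal_law.

Section admission_law.
Context {R : realType} {m : nat} (I : {set 'I_m}).
Variables (F : probability (R * R)%type R) (f1 f2 : R -> R).
Hypothesis hF : predictor F f1 f2.
Variables (K : R -> probability R R) (u : 'I_m -> R).
Variable mu : 'I_m -> probability (R * R)%type R.
Hypothesis muI : forall j, j \in I -> mu j = known_valuation K (u j).
Hypothesis muC : forall j, j \notin I -> mu j = F.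

Let L := product_prob mu.

(** A half-line ending at [t] is the section at [t] of a closed half-plane, and the measure of a
    section is measurable in [t]. *)
Lemma measurable_cdf2given1 v : measurable_fun setT (cdf2given1 K ^~ v).
Proof.
apply: (measurableT_comp (fine_measurable measurableT)).
have mA : measurable [set p : R * R | p.2 <= p.1].
  by rewrite -[X in measurable X]setTI; exact: measurable_fun_le.
apply: (eq_measurable_fun (fun t => K v (xsection [set p : R * R | p.2 <= p.1] t))).
  move=> t _; congr (K v _); apply/seteqP.
  by split => s; rewrite /xsection /= in_itv/= inE.
exact: measurable_fun_xsection.
Qed.

Lemma measurable_tail v :
  measurable_fun setT (fun t : R => K v `[t, +oo[%classic).
Proof.
have mA : measurable [set p : R * R | p.1 <= p.2].
  by rewrite -[X in measurable X]setTI; exact: measurable_fun_le.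
apply: (eq_measurable_fun (fun t => K v (xsection [set p : R * R | p.1 <= p.2] t))).
  move=> t _; congr (K v _); apply/seteqP.
  by split => s; rewrite /xsection /= in_itv/= andbT inE.
exact: measurable_fun_xsection.
Qed.

Lemma cdf2given1_compl_ge0 x v : 0 <= 1 - cdf2given1 K x v.
Proof.
rewrite subr_ge0 /cdf2given1 -lee_fin fineK ?fin_num_measure//.
exact: probability_le1.
Qed.

Lemma admitted_prod : product_prob mu (admitted I) =
  (\int[L]_x L (box (fun k => if k \in I then
     [set p | forall j, j \notin I -> ((tnth x j).2 <= p.2)%R] else setT)))%E.
Proof.
rewrite (product_prob_splice mu I); last exact: measurable_admitted.
apply: eq_integral => x _; congr (L _); apply/seteqP; split => [y|y h].
  move=> /admittedP h k; case: ifPn => //= kI j jI.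
  by move: (h j k jI kI); rewrite !tnth_mktuple kI (negbTE jI).
apply/admittedP => j k jI kI; rewrite !tnth_mktuple kI (negbTE jI).
by move: (h k); rewrite kI; exact.
Qed.

Section some_rejected.
Variables (j0 : 'I_m) (j0I : j0 \notin I).
Let M : @profile R m -> R := max_signal I j0.

Lemma admitted_max : (L (admitted I) =
  \int[L]_x \prod_(k in I) K (u k) `[M x, +oo[%classic)%E.
Proof.
rewrite [LHS]admitted_prod; apply: eq_integral => x _.
rewrite (_ : box _ = box (fun k => if k \in I then
    [set: R] `*` `[M x, +oo[%classic else setT)); last first.
  congr box; apply/funext => k; case: ifP => // _; apply/seteqP; split => [p|p [_]] /=.
    by move=> h; split => //; rewrite in_itv/= andbT; apply/max_signal_le.
  by rewrite in_itv/= andbT => /(max_signal_le j0I).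
have mR : measurable ([set: R] `*` `[M x, +oo[%classic).
  by apply: measurableX => //; exact: measurable_itv.
rewrite /L product_prob_box => [|k]; last by case: ifP.
rewrite (bigID (mem I))/= [X in (_ * X)%E]big1 ?mule1 => [|k /negbTE->]; last first.
  exact: probability_setT.
apply: eq_bigr => k kI; rewrite kI muI//.
by rewrite [LHS]known_valuation_rect// diracT mul1e.
Qed.

(* K v may have atoms, so that the two conventions P(S >= t) and P(S > t) for the
   upper tail agree only at almost every value t of the atomless maximum. *)
Lemma max_signal_not_atom v : {ae L, forall x, K v [set M x] = 0%E}.
Proof.
pose A := [set p : @profile R m * R | M p.1 = p.2].
have mA : measurable A.
  have mf : measurable_fun setT (fun p : @profile R m * R => M p.1 - p.2).
    apply: measurable_funB => //.
    exact: (measurableT_comp (measurable_max_signal I j0) measurable_fst).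
  rewrite (_ : A = (fun p => M p.1 - p.2) @^-1` [set 0]).
    by rewrite -[X in measurable X]setTI; exact: mf.
  apply/seteqP; split => p; rewrite /A /=; first by move=> ->; rewrite subrr.
  by move/eqP; rewrite subr_eq0 => /eqP.
have sA x : xsection A x = [set M x].
  by apply/seteqP; split => y; rewrite /xsection/= inE.
(* Fubini on the graph of [M]: integrating first over profiles gives 0 because [M] has no atoms, so
   integrating first over signals gives 0 as well. *)
have A0 : ((L \x K v) A = 0)%E.
  transitivity ((L \x^ K v) A)%E.
    apply: product_measure_unique => // B C mB mC.
    exact: product_measure2E.
  apply: integral0_eq => s _ /=; rewrite (_ : ysection A s = M @^-1` [set s]).
    exact: (max_signal_atomless hF muC j0I).
  by apply/seteqP; split => x; rewrite /ysection/= inE.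
have mK : measurable_fun setT (fun x => K v [set M x]).
  apply: (eq_measurable_fun (fun x => K v (xsection A x))) => [x _|].
    by rewrite sA.
  exact: measurable_fun_xsection.
have : ae_eq L setT (fun x => K v [set M x]) (cst 0%E).
  apply/ae_eq_integral_abs => //; rewrite -[RHS]A0.
  by apply: eq_integral => x _; rewrite gee0_abs//= sA.
by apply: filterS => x; exact.
Qed.

Lemma max_signal_ae_unit : {ae L, forall x, unit_itv (M x)}.
Proof.
exists (M @^-1` (~` unit_itv)); split => //.
- rewrite -[X in measurable X]setTI; apply: measurable_max_signal => //.
  by apply: measurableC; exact: measurable_itv.
- exact: (max_signal_unit_itv hF muC j0I).
Qed.

(** Change of variables along [M], whose law is the Stieltjes measure. Almost surely [M] lies in the
    unit interval and hits no atom of the laws [K (u k)], so each closed tail in [admitted_max] is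
    one minus the conditional cdf. *)
Lemma admitted_integral : (L (admitted I) =
  \int[lebesgue_stieltjes_measure (cdf2X F (m - #|I|))]_(x in unit_itv)
    (\prod_(k in I) (1 - cdf2given1 K x (u k)))%:E)%E.
Proof.
pose g x : \bar R := (\prod_(k in I) (1 - cdf2given1 K x (u k)))%:E.
have mg : measurable_fun setT g.
  apply/measurable_EFinP; rewrite /g.
  under eq_fun do rewrite big_mkcond/=.
  apply: measurable_prod => k _; case: (k \in I); last exact: measurable_cst.
  by apply: measurable_funB => //; exact: measurable_cdf2given1.
have g0 x : (0 <= g x)%E.
  by rewrite lee_fin prodr_ge0// => k _; exact: cdf2given1_compl_ge0.
have mU : measurable (unit_itv : set R) by exact: measurable_itv.
have mMU : measurable (M @^-1` unit_itv).
  by rewrite -[X in measurable X]setTI; exact: measurable_max_signal.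
have mgM : measurable_fun setT (fun x => g (M x)).
  exact: (measurableT_comp mg (measurable_max_signal I j0)).
transitivity (\int[L]_(x in M @^-1` unit_itv) g (M x))%E; last first.
  pose MTR : @profile R m -> measurableTypeR R := M.
  have mMTR : measurable_fun setT MTR := measurable_max_signal I j0.
  transitivity (\int[pushforward L MTR]_(x in unit_itv) g x)%E.
    rewrite ge0_integral_pushforward//.
    exact: (measurable_funS measurableT (@subsetT _ _) mg).
  apply: eq_measure_integral => A mA _.
  by rewrite [RHS](lebesgue_stieltjes_max_signal muC j0I).
rewrite admitted_max [RHS]integral_mkcond.
apply: ge0_ae_eq_integral => //.
- apply: emeasurable_prod => k _.
  exact: (measurableT_comp (measurable_tail (u k)) (measurable_max_signal I j0)).
- apply/(measurable_restrictT _ mMU); apply: (measurable_funS measurableT) => //.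
- by move=> x _; apply: prode_ge0.
- by move=> x _; rewrite patchE; case: ifP.
(* The bidders are finitely many, so their exceptional null sets can be merged into one. *)
have : {ae L, forall x, forall k, K (u k) [set M x] = 0%E}.
  by apply: filter_forall => k; exact: max_signal_not_atom.
move: max_signal_ae_unit; apply: filterS2 => x Ux Kx _.
rewrite patchE mem_set// /g -prodEFin; apply: eq_bigr => k kI.
exact: probability_itvcy_atomless.
Qed.
End some_rejected.

(** The product inside [psi] is symmetric, so the valuations may come in any order; the posterior
    needs this, as it lists bidder [i] first. *)
Lemma psi_admitted (s : seq R) : perm_eq s [seq u k | k <- enum I] ->
  L (admitted I) = (psi m F K s)%:E.
Proof.
move=> us; have ss : size s = #|I| by rewrite (perm_size us) size_map -cardE.
rewrite /psi ss; case: ifPn => [/eqP Im|Im].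
  suff -> : admitted I = [set: @profile R m] by exact: probability_setT.
  rewrite -subTset => x _; apply/admittedP => j k.
  have /eqP -> : I == [set: 'I_m]%SET.
    by rewrite eqEcard finset.subsetT cardsT card_ord Im /=.
  by rewrite inE.
have [j0 j0I] : exists j0, j0 \notin I.
  apply/existsP; apply: contraR Im => /existsPn h.
  rewrite (_ : I = [set: 'I_m]%SET) ?cardsT ?card_ord//.
  by apply/setP => j; rewrite inE; apply/negPn/h.
rewrite /Rintegral; under eq_integral => x _.
  rewrite (perm_big _ us) big_map big_enum; over.
by rewrite -(admitted_integral j0I) fineK// fin_num_measure//; exact: measurable_admitted.
Qed.

End admission_law.

(** * Integration against measures given by densities *)

Section change_of_density.
Context {d : measure_display} {T : measurableType d} {R : realType}.

(** The given density agrees almost everywhere with the Radon-Nikodym derivative, for which the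
    change of variables is known. *)
Lemma ge0_integral_density (nu mu : probability T R) (phi h : T -> \bar R) :
  measurable_fun setT phi -> (forall x, 0 <= phi x)%E ->
  (forall A, measurable A -> nu A = \int[mu]_(x in A) phi x)%E ->
  measurable_fun setT h -> (forall x, 0 <= h x)%E ->
  forall A, measurable A ->
  (\int[nu]_(x in A) h x = \int[mu]_(x in A) (h x * phi x))%E.
Proof.
move=> mphi phi0 nuE mh h0 A mA.
have numu : nu `<< mu.
  apply/null_content_dominatesP => B mB B0; rewrite nuE//.
  by apply: null_set_integral => //; exact: measurable_funS mphi.
have dphi : ae_eq mu setT (Radon_Nikodym_SigmaFinite.f nu mu) phi.
  apply: integral_ae_eq => //.
    exact: Radon_Nikodym_SigmaFinite.f_integrable.
  move=> E _ mE; transitivity (nu E); last exact: nuE.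
  exact/esym/Radon_Nikodym_SigmaFinite.f_integral.
have mhA : measurable_fun A h by exact: measurable_funS mh.
have mphiA : measurable_fun A phi by exact: measurable_funS mphi.
have mRN : measurable_fun setT (Radon_Nikodym_SigmaFinite.f nu mu).
  exact: measurable_int (Radon_Nikodym_SigmaFinite.f_integrable numu).
rewrite -(Radon_Nikodym_SigmaFinite.change_of_variables numu)//.
apply: ge0_ae_eq_integral => //.
- by apply: emeasurable_funM => //; exact: measurable_funS mRN.
- exact: emeasurable_funM.
- by move=> x _; rewrite mule_ge0// Radon_Nikodym_SigmaFinite.f_ge0.
- by move=> x _; rewrite mule_ge0.
- by move: dphi; apply: filterS => x /(_ I) -> _.
Qed.

(** The right-hand side is a mixture over [t] of point masses weighted by the product of the
    densities. It is therefore determined by boxes, on which the integral factors. *)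
Lemma product_density n (mu lam : 'I_n -> probability T R) (h : 'I_n -> T -> R) :
  (forall j, measurable_fun setT (h j)) -> (forall j x, 0 <= h j x) ->
  (forall j A, measurable A -> mu j A = \int[lam j]_(x in A) (h j x)%:E)%E ->
  forall A, measurable A -> (product_prob mu A =
    \int[product_prob lam]_(t in A) (\prod_j h j (tnth t j))%:E)%E.
Proof.
move=> mh h0 muE A mA.
have q0 (t : n.-tuple T) : 0 <= \prod_j h j (tnth t j) by exact: prodr_ge0.
pose q t : {nonneg R} := NngNum (q0 t).
pose Q t : {measure set (n.-tuple T) -> \bar R} := mscale (q t) (\d_t).
have QE t B : Q t B = ((fun t => (\prod_j h j (tnth t j))%:E) \_ B) t.
  rewrite -[LHS]/((q t)%:num%:E * \d_t B)%E diracE patchE.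
  by case: ifP => _; rewrite ?mule1 ?mule0.
have mq : measurable_fun setT (fun t : n.-tuple T => (\prod_j h j (tnth t j))%:E).
  apply/measurable_EFinP; apply: measurable_prod => j _.
  exact: (measurableT_comp (mh j) (@measurable_tnth _ _ _ j)).
transitivity (\int[product_prob lam]_(t in setT) Q t A)%E; last first.
  by rewrite [RHS]integral_mkcond; apply: eq_integral => t _; exact: QE.
apply: (@kernel_mixture_unique _ _ _ _ _ (product_prob lam)
    (product_prob mu) _ Q (@boxes _ _ n)) => //.
- move=> B mB; apply: (eq_measurable_fun
    ((fun t => (\prod_j h j (tnth t j))%:E) \_ B)).
    by move=> t _; rewrite QE.
  by apply/(measurable_restrictT _ mB); exact: measurable_funS mq.
- exact: measurable_boxesE.
- exact: boxes_setI.
- exact: boxesT.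
move=> _ [E mE <-]; rewrite [LHS]product_prob_box//.
transitivity (\prod_j \int[lam j]_x ((fun x => (h j x)%:E) \_ (E j)) x)%E.
  by apply: eq_bigr => j _; rewrite muE// integral_mkcond.
rewrite -ge0_integral_prod_tuple; last 2 first.
- move=> j; apply/(measurable_restrictT _ (mE j)); apply/measurable_EFinP.
  exact: measurable_funS (mh j).
- by move=> j x; rewrite patchE; case: ifP => // _; rewrite lee_fin.
apply: eq_integral => t _; rewrite QE patchE; case: ifPn => [/set_mem tE|tE].
  by rewrite -prodEFin; apply: eq_bigr => j _; rewrite patchE mem_set.
have [j tj] : exists j, ~ E j (tnth t j).
  by apply/existsNP => hE; move/negP: tE; apply; exact: mem_set.
by rewrite (bigD1 j)//= patchE memNset// mul0e.
Qed.

End change_of_density.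

(** * Law and density of the rivals' valuations *)

Section valuation_law.
Context {R : realType} {k n : nat} (F : probability (R * R)%type R).
Variables (g : 'I_k -> 'I_n) (g_inj : injective g).
Variable mu : 'I_n -> probability (R * R)%type R.
Hypothesis mug : forall l, mu (g l) = F.

Let fst' : R * R -> R := fst.
#[local] HB.instance Definition _ :=
  isMeasurableFun.Build _ _ _ _ fst' measurable_fst.

Definition valuation_law : probability R R := distribution F fst'.

(** Since [g] is injective, the listed bidders are distinct, hence independent; the remaining
    coordinates are unconstrained and contribute factors 1. *)
Lemma product_prob_valuations_at A : measurable A ->
  product_prob mu (valuations_at g @^-1` A) =
  product_prob (fun _ : 'I_k => valuation_law) A.
Proof.
pose Y : {mfun _ >-> _} := HB.pack (valuations_at g : n.-tuple (R * R) -> _)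
  (isMeasurableFun.Build _ _ _ _ _ (measurable_valuations_at g)).
rewrite -[X in _ -> X = _]/(distribution (product_prob mu) Y A).
move: A; apply: tuple_measure_unique => B mB.
pose D j := \bigcap_(l in [set l | g l = j]) B l.
have mD j : measurable (D j) by exact: fin_bigcap_measurable.
have mfD j : measurable (fst @^-1` D j : set (R * R)).
  by rewrite -[X in measurable X]setTI; exact: measurable_fst.
transitivity (product_prob mu (box (fun j => fst @^-1` D j))).
  rewrite [LHS]/= /distribution /pushforward; congr (product_prob mu _).
  apply/seteqP; split => [x h j l /= <-|x h l /=].
    by move: (h l); rewrite tnth_mktuple.
  by rewrite tnth_mktuple; exact: (h (g l)).
rewrite product_prob_box// [RHS]product_prob_box//.
rewrite (bigID (mem (g @: [set: 'I_k]%SET)))/= [X in (_ * X)%E]big1 ?mule1; last first.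
  move=> j /imsetP jg; rewrite (_ : D j = setT) ?preimage_setT ?probability_setT//.
  by rewrite -subTset => x _ l /= gl; case: jg; exists l; rewrite ?inE.
rewrite big_imset/=; last by move=> l l' _ _; exact: g_inj.
apply: eq_big => [l|l _]; first by rewrite inE.
rewrite mug /valuation_law -[RHS]/(F (fst @^-1` B l)); congr (F _).
apply/seteqP; split => [p h|p h l' /= /g_inj ->//]; exact: (h l).
Qed.

End valuation_law.

Section valuation_density.
Context {R : realType} (F : probability (R * R)%type R) (f1 f2 : R -> R).
Hypothesis hF : predictor F f1 f2.

Lemma measurable_unit_itv : measurable (unit_itv : set R).
Proof. exact: measurable_itv. Qed.

(** [f1] is controlled on the unit interval only; extending it by zero makes it measurable and
    nonnegative on the whole line. *)
Definition density_patch : R -> R := f1 \_ unit_itv.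

Lemma measurable_density_patch : measurable_fun setT density_patch.
Proof.
by apply/(measurable_restrictT _ measurable_unit_itv); case: hF => _ [].
Qed.

Lemma density_patch_ge0 x : 0 <= density_patch x.
Proof.
rewrite /density_patch patchE; case: ifPn => // /set_mem.
rewrite /unit_itv /= in_itv/= => x01.
by case: hF => _ [_ f10 _] _ _; exact/ltW/f10.
Qed.

Lemma valuation_law_density A : measurable A ->
  (valuation_law F A = \int[@lebesgue01 R]_(x in A) (density_patch x)%:E)%E.
Proof.
move=> mA; case: hF => _ [mf1 f10 f1E] _ _.
have mAU : measurable (A `&` unit_itv).
  by apply: measurableI => //; exact: measurable_unit_itv.
rewrite -[LHS]/(pushforward F fst A) f1E//.
(* The identity transports the integral from [measurableTypeR R], where [lebesgue_measure] lives, to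
   [R], where [lebesgue01] lives. *)
pose idR : measurableTypeR R -> R := idfun.
have midR : measurable_fun setT idR by exact: measurable_id.
have mphi : measurable_fun (A `&` unit_itv) (fun x => (density_patch x)%:E).
  by apply/measurable_EFinP; exact: measurable_funS measurable_density_patch.
transitivity (\int[pushforward lebesgue_measure idR]_(x in A `&` unit_itv)
    (density_patch x)%:E)%E.
  rewrite ge0_integral_pushforward//; last first.
    by move=> x _; rewrite lee_fin density_patch_ge0.
  apply: eq_integral => x /set_mem [_ Ux].
  by rewrite /= /density_patch patchE mem_set.
rewrite [RHS](_ : _ = \int[@lebesgue01 R]_(x in A `&` unit_itv) (density_patch x)%:E)%E.
  apply: eq_measure_integral => B mB BU.
  rewrite /pushforward /= /lebesgue01 setIidl//.
  by apply: subset_trans BU _; exact: subIsetr.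
rewrite [RHS]integral_mkcondr; apply: eq_integral => x _.
by rewrite patchE /density_patch patchE; case: ifP.
Qed.

Lemma measurable_cube k : measurable (cube k : set (k.-tuple R)).
Proof.
rewrite (_ : cube k = box (fun=> unit_itv)).
  by apply: measurable_box => j; exact: measurable_unit_itv.
by apply/seteqP; split => t h j; move: (h j); rewrite /unit_itv /= in_itv.
Qed.

Lemma prod_density_patch k (w : k.-tuple R) :
  \prod_j density_patch (tnth w j) =
  ((fun w : k.-tuple R => \prod_(u <- w) f1 u) \_ (cube k)) w.
Proof.
rewrite patchE; case: ifPn => [/set_mem wU|wU].
  rewrite big_tuple; apply: eq_bigr => j _.
  by rewrite /density_patch patchE mem_set// /unit_itv /= in_itv/=; exact: wU.
have [j wj] : exists j, ~ 0 <= tnth w j <= 1.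
  by apply/existsNP => h; move/negP: wU; apply; exact: mem_set.
rewrite (bigD1 j)//= /density_patch patchE memNset ?mul0r//.
Qed.

Lemma measurable_prod_density k : measurable_fun (cube k : set (k.-tuple R))
  (fun w => \prod_(u <- w) f1 u).
Proof.
apply: (eq_measurable_fun (fun w : k.-tuple R => \prod_j density_patch (tnth w j))).
  by move=> w wU; rewrite prod_density_patch patchE wU.
apply: (measurable_funS measurableT) => //; apply: measurable_prod => j _.
exact: (measurableT_comp measurable_density_patch (@measurable_tnth _ _ _ j)).
Qed.

(** The patched product density vanishes outside the cube, which confines the integral to the
    cube. *)
Lemma integral_valuations_law k (h : k.-tuple R -> R) B :
  measurable_fun setT h -> (forall w, 0 <= h w) -> measurable B ->
  (\int[product_prob (fun _ : 'I_k => valuation_law F)]_(w in B) (h w)%:E =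
   \int[lebesgue_cube k]_(w in B `&` cube k) (h w * \prod_(u <- w) f1 u)%:E)%E.
Proof.
move=> mh h0 mB.
transitivity (\int[lebesgue_cube k]_(w in B)
    ((h w)%:E * (\prod_j density_patch (tnth w j))%:E))%E; last first.
  rewrite [RHS]integral_mkcondr; apply: eq_integral => w _.
  rewrite prod_density_patch -EFinM !patchE.
  by case: ifP => _; rewrite ?mulr0.
apply: ge0_integral_density => //.
- apply/measurable_EFinP; apply: measurable_prod => j _.
  exact: (measurableT_comp measurable_density_patch (@measurable_tnth _ _ _ j)).
- by move=> w; rewrite lee_fin prodr_ge0// => j _; exact: density_patch_ge0.
- apply: (product_density (h := fun=> density_patch)) => [j|j x|j A mA].
  + exact: measurable_density_patch.
  + exact: density_patch_ge0.
  + exact: valuation_law_density.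
- exact/measurable_EFinP.
Qed.

End valuation_density.

(** * Joint law of admission and the rivals' valuations given [vi] *)

Section posterior.
Context {R : realType} {m : nat} (I : {set 'I_m}) (i : 'I_m).
Hypothesis iI : i \in I.
Variables (F : probability (R * R)%type R) (f1 f2 : R -> R).
Hypothesis hF : predictor F f1 f2.
Variables (K : R -> probability R R) (hK : regular_cond_law F snd fst K).
Variable (vi : R).

Let J := I :\ i.
Let k := #|I|.-1.
Let g (l : 'I_k) : 'I_m := nth i (enum J) l.

Let cardJ : #|J| = k.
Proof. by rewrite /k (cardsD1 i I) iI. Qed.

Let gJ l : g l \in J.
Proof. by rewrite -mem_enum mem_nth// -cardE cardJ. Qed.

Let g_inj : injective g.
Proof.
move=> l l' /eqP; rewrite nth_uniq ?enum_uniq// -?cardE ?cardJ//.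
by move=> /eqP/val_inj.
Qed.

Let mu (j : 'I_m) : probability (R * R)%type R :=
  if j \in [set i]%SET%SET
  then known_valuation K (nth 0 [:: vi] (index j (enum [set i]%SET))) else F.

Let L := cond_law F K [set i]%SET [:: vi].

Let muJ j : j \in J -> mu j = F.
Proof. by rewrite /mu !inE => /andP[/negbTE->]. Qed.

(** The assignment of valuations to bidders; the value [vi] taken outside [J] is meant for [i], the
    only member of [I] there. *)
Let u (w : k.-tuple R) (j : 'I_m) :=
  if j \in J then nth 0 w (index j (enum J)) else vi.

Let perm_u (w : k.-tuple R) : perm_eq (vi :: w) [seq u w j | j <- enum I].
Proof.
apply: (@perm_trans _ [seq u w j | j <- i :: enum J]); last first.
  apply: perm_map; apply: uniq_perm; rewrite /= ?enum_uniq ?mem_enum ?setD11//.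
  by move=> j; rewrite in_cons !mem_enum !inE; case: eqP => [->|].
rewrite /= {1}/u setD11 perm_cons.
rewrite (_ : [seq u w j | j <- enum J] = w) ?perm_refl//.
have sJ : size (enum J) = k by rewrite -cardE cardJ.
apply: (@eq_from_nth _ 0); rewrite size_map sJ ?size_tuple// => l lk.
rewrite (nth_map i) ?sJ// /u -mem_enum mem_nth ?sJ//.
by rewrite index_uniq ?sJ// enum_uniq.
Qed.

(** [mu] already fixes the valuation of [i]; revealing those in [J] as well fixes all valuations in
    [I] and leaves the rejected bidders with law [F]. *)
Let psiE (w : k.-tuple R) : product_prob (fun j => if j \in J
    then known_valuation K (nth 0 w (index j (enum J))) else mu j) (admitted I) =
  (psi m F K (vi :: w))%:E.
Proof.
apply: (psi_admitted hF (u := u w)) => //.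
- move=> j jI; rewrite /u /mu; case: ifP => // jJ.
  have -> : j = i by apply/eqP; move: jJ; rewrite !inE jI andbT => /negbFE.
  by rewrite inE eqxx /= enum_set1 /= eqxx.
- move=> j jI; rewrite /mu !inE (negbTE jI) andbF.
  by case: eqP => // ji; move: jI; rewrite ji iI.
Qed.

(** By [psiE], [psi] is the value of a measurable product kernel at the admission event. *)
Lemma measurable_psi_cons :
  measurable_fun setT (fun w : k.-tuple R => psi m F K (vi :: w)).
Proof.
apply/measurable_EFinP; rewrite /comp.
under eq_fun do rewrite -psiE.
apply: (measurable_product_prob (k := fun j (w : k.-tuple R) => if j \in J
  then known_valuation K (nth 0 w (index j (enum J))) else mu j)) => //.
  move=> j A mA; case: (j \in J); last exact: measurable_cst.
  exact: (measurableT_comp (measurable_known_valuation hK.1 mA)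
    (@measurable_nth_tuple _ _ _)).
exact: measurable_admitted.
Qed.

Lemma psi_cons_ge0 (w : k.-tuple R) : 0 <= psi m F K (vi :: w).
Proof. by rewrite -lee_fin -psiE. Qed.

(** Disintegrating along the rivals' valuations turns the joint probability into an integral of
    [psi] over their law, which has the product density. *)
Lemma posterior_integral B : measurable B ->
  (L (admitted I `&` @rival_valuations R m k I i @^-1` B) =
   \int[lebesgue_cube k]_(w in B `&` cube k)
     (psi m F K (vi :: w) * \prod_(v <- w) f1 v)%:E)%E.
Proof.
move=> mB.
(* [mu] and [g] are spelled so that [cond_law] and [rival_valuations] unfold to them. *)
rewrite -[LHS]/(product_prob mu (admitted I `&` valuations_at g @^-1` B)).
rewrite (revealed_cond hK muJ gJ)//; last exact: measurable_admitted.
transitivity (\int[product_prob mu]_(x in valuations_at g @^-1` B)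
    (psi m F K (vi :: valuations_at g x))%:E)%E.
  apply: eq_integral => x _; rewrite -psiE; congr (product_prob _ _).
  apply/funext => j; rewrite /revealed; case: ifP => // jJ; congr known_valuation.
  have jk : (index j (enum J) < k)%N by rewrite -cardJ cardE index_mem mem_enum.
  rewrite -[index _ _]/(nat_of_ord (Ordinal jk)) -tnth_nth tnth_mktuple.
  by rewrite /g /= nth_index// mem_enum.
pose Y : {mfun _ >-> _} := HB.pack (valuations_at g : m.-tuple (R * R) -> _)
  (isMeasurableFun.Build _ _ _ _ _ (measurable_valuations_at g)).
transitivity (\int[pushforward (product_prob mu) Y]_(w in B)
    (psi m F K (vi :: w))%:E)%E.
  rewrite ge0_integral_pushforward//.
    by apply/measurable_EFinP; exact: measurable_funS measurable_psi_cons.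
  by move=> w _; rewrite lee_fin psi_cons_ge0.
rewrite -(integral_valuations_law hF measurable_psi_cons psi_cons_ge0 mB).
apply: eq_measure_integral => A mA _.
exact: (product_prob_valuations_at g_inj (fun l => muJ (gJ l))).
Qed.

End posterior.

(** * The posterior formula, its normalization and its uniqueness *)

Lemma cond_law_admitted (R : realType) (m n : nat)
    (F : probability (R * R)%type R) (f1 f2 : R -> R) (hF : predictor F f1 f2)
    (K : R -> probability R R) (I : {set 'I_m}) (v : n.-tuple R) :
  #|I| = n -> cond_law F K I v (admitted I) = (psi m F K v)%:E.
Proof.
move=> In; pose u j := nth 0 v (index j (enum I)).
have sI : size (enum I) = n by rewrite -cardE.
apply: (psi_admitted hF (u := u)) => [j jI|j /negbTE jI|]; rewrite ?jI//.
rewrite (_ : [seq u j | j <- enum I] = v) ?perm_refl//.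
apply: (@eq_from_nth _ 0); rewrite size_map sI ?size_tuple// => l ln.
have [i0 _] : exists i0 : 'I_m, i0 \in enum I.
  by case: (enum I) sI ln => [<-//|i0 e _ _]; exists i0; rewrite mem_head.
by rewrite (nth_map i0) ?sI// /u index_uniq ?sI// enum_uniq.
Qed.

Theorem lemma1 (R : realType) (m n : nat) (hm : (2 <= m)%N)
    (hn : (2 <= n <= m)%N)
    (F : probability (R * R)%type R) (f1 f2 : R -> R)
    (hF : predictor F f1 f2)
    (K : R -> probability R R) (hK : regular_cond_law F snd fst K)
    (d : measure_display) (Omega : measurableType d) (P : probability Omega R)
    (X : 'I_m -> {mfun Omega >-> (R * R)%type}) (hX : iid_bidders P F X) :
  [/\ (forall J : {set 'I_m},
         regular_cond_law P (profile_of X) (valuations_of X J)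
           (fun v : #|J|.-tuple R => cond_law F K J v)),
      (forall (I : {set 'I_m}) (v : n.-tuple R), #|I| = n -> cube n v ->
         cond_law F K I v (admitted I) = (psi m F K v)%:E) &
      exists kappa : R -> R,
        forall (I : {set 'I_m}) (i : 'I_m) (vi : R),
          #|I| = n -> i \in I -> 0 <= vi <= 1 ->
          (0 < cond_law F K [set i] [:: vi] (admitted I))%E ->
          let beta (w : n.-1.-tuple R) :=
            kappa vi * psi m F K (vi :: w) * \prod_(u <- w) f1 u in
          [/\ (\int[lebesgue_cube n.-1]_(w in cube n.-1) (beta w)%:E
                 = 1)%E,
              posterior_density F K I i vi beta &
              (forall b : n.-1.-tuple R -> R,
                 posterior_density F K I i vi b ->
                 {ae lebesgue_cube n.-1,
                   forall w, cube n.-1 w -> b w = beta w})]].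
Proof.
split.
- by move=> J; exact: cond_law_regular.
- by move=> I v In _; exact: (cond_law_admitted hF).
pose Z vi := fine (\int[lebesgue_cube n.-1]_(w in cube n.-1)
  (psi m F K (vi :: w) * \prod_(v <- w) f1 v)%:E)%E.
exists (fun vi => (Z vi)^-1) => I i vi In iI _ L0 beta.
set L := cond_law F K [set i]%SET [:: vi] in L0 *.
have mcube : measurable (cube n.-1 : set (n.-1.-tuple R)) by exact: measurable_cube.
have LB B : measurable B ->
    (L (admitted I `&` @rival_valuations R m n.-1 I i @^-1` B) =
     \int[lebesgue_cube n.-1]_(w in B `&` cube n.-1)
       (psi m F K (vi :: w) * \prod_(v <- w) f1 v)%:E)%E.
  by move: B; rewrite -In => B; exact: (posterior_integral iI hF hK).
have LT : (L (admitted I) = \int[lebesgue_cube n.-1]_(w in cube n.-1)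
    (psi m F K (vi :: w) * \prod_(v <- w) f1 v)%:E)%E.
  by have := LB setT measurableT; rewrite preimage_setT setIT setTI.
have Lfin : L (admitted I) \is a fin_num.
  by rewrite fin_num_measure//; exact: measurable_admitted.
have ZE : (Z vi)%:E = L (admitted I) by rewrite /Z -LT fineK.
have Z0 : 0 < Z vi by rewrite -lte_fin ZE.
have mpsi : measurable_fun setT (fun w : n.-1.-tuple R => psi m F K (vi :: w)).
  by rewrite -In; exact: (measurable_psi_cons iI hF hK).
have psi0 (w : n.-1.-tuple R) : 0 <= psi m F K (vi :: w).
  by move: w; rewrite -In => w; exact: (psi_cons_ge0 iI hF).
have mprod := @measurable_prod_density _ _ _ _ hF n.-1.
have mpf : measurable_fun (cube n.-1) (fun w : n.-1.-tuple R =>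
    psi m F K (vi :: w) * \prod_(v <- w) f1 v).
  by apply: measurable_funM => //; exact: measurable_funS mpsi.
have prod0 (w : n.-1.-tuple R) : cube n.-1 w -> 0 <= \prod_(v <- w) f1 v.
  move=> wU; rewrite big_tuple; apply: prodr_ge0 => j _.
  by case: hF => _ [_ f10 _] _ _; exact/ltW/f10/wU.
have mbeta : measurable_fun (cube n.-1) beta.
  rewrite (_ : beta = fun w => (Z vi)^-1 *
    (psi m F K (vi :: w) * \prod_(v <- w) f1 v)); first exact: measurable_funM.
  by apply/funext => w; rewrite /beta mulrA.
have beta0 w : cube n.-1 w -> 0 <= beta w.
  by move=> wU; rewrite /beta !mulr_ge0 ?prod0// invr_ge0 ltW.
have beta_int B : measurable B ->
    (\int[lebesgue_cube n.-1]_(w in B `&` cube n.-1) (beta w)%:E =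
     (Z vi)^-1%:E * L (admitted I `&` @rival_valuations R m n.-1 I i @^-1` B))%E.
  move=> mB; rewrite LB// -ge0_integralZl//.
  - by apply: eq_integral => w _; rewrite -EFinM mulrA.
  - exact: measurableI.
  - by apply/measurable_EFinP; exact: measurable_funS mpf.
  - by move=> w [_ wU]; rewrite lee_fin mulr_ge0 ?prod0.
  - by rewrite lee_fin invr_ge0 ltW.
have beta1 : (\int[lebesgue_cube n.-1]_(w in cube n.-1) (beta w)%:E = 1)%E.
  have := beta_int setT measurableT.
  by rewrite preimage_setT setIT setTI -ZE -EFinM mulVf ?gt_eqF.
have betaP : posterior_density F K I i vi beta.
  split => // B mB; rewrite beta_int// -/L -ZE muleA -EFinM mulfV ?gt_eqF//.
  by rewrite mul1e.
split => // b [mb b0 bP].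
(* Multiplying the posterior identities by the inverse of [Z vi] shows that both densities have the
   same integral over every measurable part of the cube; [beta] is integrable, having mass 1. *)
have : ae_eq (lebesgue_cube n.-1) (cube n.-1) (EFin \o beta) (EFin \o b).
  apply: integral_ae_eq => //.
  - apply/integrableP; split; first exact/measurable_EFinP.
    rewrite (eq_integral (fun w => (beta w)%:E)) ?beta1 ?ltry// => w /set_mem wU.
    by rewrite gee0_abs// lee_fin beta0.
  - exact/measurable_EFinP.
  - move=> E EU mE; case: betaP => _ _ /(_ E mE); rewrite bP// setIidl//.
    rewrite -/L -ZE => /(congr1 (fun z => (Z vi)^-1%:E * z)%E).
    by rewrite !muleA -EFinM mulVf ?gt_eqF// !mul1e => ->.
by apply: filterS => w bw wU; have [] := bw wU.
Qed.
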